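(* Let $i_1,i_2,i_3\ge 0$ be integers and let $\mu,\alpha,\beta$ be elements of $K$ satisfying $\nu(\wp(\mu))\ge i_2-pi_1$, $\nu(\wp(\alpha)+\wp(\mu)\beta)\ge i_3-pi_1$ and $\nu(\wp(\beta))\ge i_3-pi_2$. Let $$H^*_{i_1,i_2,i_3,\mu,\alpha,\beta} = R[\pi^{i_1}(\xi_{1,0,0}-\mu\xi_{0,1,0}-\alpha\xi_{0,0,1}),\ \pi^{i_2}(\xi_{0,1,0}-\beta\xi_{0,0,1}),\ \pi^{i_3}\xi_{0,0,1}]$$ be the $R$-subalgebra of $(K[C_p^3])^*$ generated by the indicated elements. Then $H^*_{i_1,i_2,i_3,\mu,\alpha,\beta}$ is an $R$-Hopf order in $(K[C_p^3])^*$.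
   Context: Let $p$ be a prime and let $K$ be a field of characteristic $p$ that is complete with respect to a discrete valuation $\nu:K\to\mathbb{Z}\cup\{\infty\}$ with uniformizing parameter $\pi$, $\nu(\pi)=1$. Let $R=\{x\in K\mid \nu(x)\ge 0\}$. For $x\in K$ put $\wp(x)=x^p-x$. For a finite dimensional $K$-Hopf algebra $B$, an $R$-Hopf order in $B$ is an $R$-Hopf algebra $H$ which is a finitely generated projective (hence free) $R$-submodule of $B$ with $K\otimes_R H\cong B$ as $K$-Hopf algebras; the comultiplication, counit and coinverse of $H$ are those induced from $B$. $C_p^3=\langle g_1,g_2,g_3\rangle$ is the elementary abelian group of order $p^3$, $(K[C_p^3])^*$ is the linear dual of the group ring, and $\langle -,-\rangle:(K[C_p^3])^*\times K[C_p^3]\to K$ is the duality pairing. The elements $\xi_{1,0,0},\xi_{0,1,0},\xi_{0,0,1}\in (K[C_p^3])^*$ are defined by $\langle \xi_{1,0,0},(g_1-1)^j(g_2-1)^k(g_3-1)^l\rangle=\delta_{1,j}\delta_{0,k}\delta_{0,l}$, $\langle \xi_{0,1,0},(g_1-1)^j(g_2-1)^k(g_3-1)^l\rangle=\delta_{0,j}\delta_{1,k}\delta_{0,l}$, $\langle \xi_{0,0,1},(g_1-1)^j(g_2-1)^k(g_3-1)^l\rangle=\delta_{0,j}\delta_{0,k}\delta_{1,l}$ for $0\le j,k,l\le p-1$. They are primitive, each satisfies $\xi^p=\xi$, and they generate $(K[C_p^3])^*$ as a $K$-algebra. *)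

(* Defs.v *)
From HB Require Import structures.
From mathcomp Require Import all_boot all_order all_algebra all_fingroup.
From mathcomp Require Import all_solvable all_field.
From mathcomp Require Import classical_sets constructive_ereal.

Set Implicit Arguments.
Unset Strict Implicit.
Unset Printing Implicit Defensive.

Import Order.TTheory GRing.Theory Num.Theory.

Local Open Scope ring_scope.

Section Tensor.
Variable K : fieldType.

(* The entries of a tensor are its coordinates on the products of the elements
   of the distinguished bases [vbasis]. *)
Definition tensor (U V : vectType K) : Type := 'M[K]_(\dim {:U}, \dim {:V}).

Definition tens (U V : vectType K) (u : U) (v : V) : tensor U V :=
  \matrix_(i, j) (coord (vbasis {:U}) i u * coord (vbasis {:V}) j v).

(* The linear map on U (x) V induced by b; only meaningful for bilinear b, see
   [tlift_tens]. *)
Definition tlift (U V : vectType K) (W : lmodType K) (b : U -> V -> W)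
    (t : tensor U V) : W :=
  \sum_i \sum_j (t : 'M_(_, _)) i j *: b (vbasis {:U})`_i (vbasis {:V})`_j.

Definition tmap (U V U' V' : vectType K) (f : U -> U') (g : V -> V') :
    tensor U V -> tensor U' V' :=
  tlift (fun u v => tens (f u) (g v)).

Definition tassoc (U V W : vectType K) :
    tensor (tensor U V) W -> tensor U (tensor V W) :=
  tlift (fun t w => tlift (fun u v => tens u (tens v w)) t).

Definition tmul (A : falgType K) (s t : tensor A A) : tensor A A :=
  tlift (fun a b => tlift (fun c d => tens (a * c) (b * d)) t) s.

Definition bilin (U V W : lmodType K) (b : U -> V -> W) :=
  (forall v, linear (b^~ v)) /\ (forall u, linear (b u)).

Section Theory.
Variables U V : vectType K.
Implicit Types (u : U) (v : V) (t : tensor U V).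

Lemma bilin_tens : bilin (@tens U V).
Proof.
split=> [v a u u' | u a v v']; apply/matrixP=> i j; rewrite !mxE linearP /=.
  by rewrite mulrDl mulrA.
by rewrite mulrDr mulrCA.
Qed.

Lemma tlift_is_linear (W : lmodType K) (b : U -> V -> W) : linear (tlift b).
Proof.
move=> a s t; rewrite /tlift scaler_sumr -big_split /=; apply: eq_bigr => i _.
rewrite scaler_sumr -big_split /=; apply: eq_bigr => j _.
by rewrite !mxE scalerDl scalerA.
Qed.

HB.instance Definition _ (W : lmodType K) (b : U -> V -> W) :=
  GRing.isLinear.Build K (tensor U V) W _ (tlift b) (tlift_is_linear b).

Lemma eq_tlift (W : lmodType K) (b b' : U -> V -> W) t :
  (forall u v, b u v = b' u v) -> tlift b t = tlift b' t.
Proof.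
by move=> eqb; apply: eq_bigr => i _; apply: eq_bigr => j _; rewrite eqb.
Qed.

Lemma tlift_tens (W : lmodType K) (b : U -> V -> W) u v :
  bilin b -> tlift b (tens u v) = b u v.
Proof.
case=> linl linr.
pose bl v := GRing.isLinear.Build K U W _ (b^~ v) (linl v).
pose br u := GRing.isLinear.Build K V W _ (b u) (linr u).
pose fl v : {linear U -> W} := HB.pack (b^~ v) (bl v).
pose fr u : {linear V -> W} := HB.pack (b u) (br u).
rewrite {2}(coord_vbasis (memvf u)) -[RHS]/(fl v _) linear_sum /=.
apply: eq_bigr => i _; rewrite -[b _ v]/(fl v _) linearZ /=.
rewrite {2}(coord_vbasis (memvf v)) -[b _ _]/(fr _ _) linear_sum /=.
rewrite scaler_sumr; apply: eq_bigr => j _.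
by rewrite -[b _ (_ *: _)]/(fr _ _) linearZ /= mxE scalerA.
Qed.

Lemma linear_tlift (W W' : lmodType K) (f : {linear W -> W'})
    (b : U -> V -> W) t :
  f (tlift b t) = tlift (fun u v => f (b u v)) t.
Proof.
rewrite /tlift linear_sum; apply: eq_bigr => i _; rewrite linear_sum.
by apply: eq_bigr => j _; rewrite linearZ.
Qed.

Lemma tlift_id t : tlift (@tens U V) t = t.
Proof.
apply/matrixP=> i j; rewrite summxE (bigD1 i) //= [X in _ + X]big1 ?addr0.
  rewrite summxE (bigD1 j) //= [X in _ + X]big1 ?addr0.
    by rewrite !mxE !coord_free ?(basis_free (vbasisP _)) // !eqxx !mulr1.
  move=> k nkj; rewrite !mxE !coord_free ?(basis_free (vbasisP _)) //.
  by rewrite (negPf nkj) !mulr0.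
move=> k nki; rewrite summxE big1 // => l _.
rewrite !mxE !coord_free ?(basis_free (vbasisP _)) //.
by rewrite (negPf nki) mul0r mulr0.
Qed.

Lemma tensor_ind (P : tensor U V -> Prop) :
    (forall u v, P (tens u v)) ->
    (forall a s t, P s -> P t -> P (a *: s + t)) ->
  forall t, P t.
Proof.
move=> Ptens PD t.
have P0 : P 0 by move: (PD (-1) _ _ (Ptens 0 0) (Ptens 0 0)); rewrite scaleN1r addNr.
have Psum n (F : 'I_n -> tensor U V) : (forall i, P (F i)) -> P (\sum_i F i).
  move=> PF; elim/big_ind: _ => // s r Ps Pr.
  by rewrite -[s]scale1r; apply: PD.
rewrite -(tlift_id t); apply: (Psum _ _) => i; apply: (Psum _ _) => j.
by rewrite -[_ *: _]addr0; apply: PD.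
Qed.

Lemma tlift_exchange (U' V' : vectType K) (W : lmodType K)
    (b : U -> V -> U' -> V' -> W) t (t' : tensor U' V') :
  tlift (fun u v => tlift (b u v) t') t =
  tlift (fun x y => tlift (fun u v => b u v x y) t) t'.
Proof.
rewrite /tlift.
under eq_bigr => i _ do under eq_bigr => j _ do rewrite scaler_sumr.
under eq_bigr => i _ do rewrite exchange_big /=.
rewrite exchange_big /=; apply: eq_bigr => k _.
under eq_bigr => i _ do under eq_bigr => j _ do rewrite scaler_sumr.
under eq_bigr => i _ do rewrite exchange_big /=.
rewrite exchange_big /=; apply: eq_bigr => l _.
rewrite scaler_sumr; apply: eq_bigr => i _.
rewrite scaler_sumr; apply: eq_bigr => j _.
by rewrite !scalerA mulrC.
Qed.

End Theory.
End Tensor.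

Record hopfAlgebra (K : fieldType) := HopfAlgebra {
  hopf_alg :> falgType K;
  comul : {linear hopf_alg -> tensor hopf_alg hopf_alg};
  counit : {linear hopf_alg -> K^o};
  antipode : {linear hopf_alg -> hopf_alg};
  comulA : forall a, tassoc (tmap comul id (comul a)) = tmap id comul (comul a);
  counitl : forall a, tlift (fun x y => counit x *: y) (comul a) = a;
  counitr : forall a, tlift (fun x y => counit y *: x) (comul a) = a;
  comul1 : comul 1 = tens 1 1;
  comulM : forall a b, comul (a * b) = tmul (comul a) (comul b);
  counit1 : counit 1 = 1;
  counitM : forall a b, counit (a * b) = counit a * counit b;
  antipodel : forall a,
    tlift (fun x y => antipode x * y) (comul a) = counit a *: 1;
  antipoder : forall a,
    tlift (fun x y => x * antipode y) (comul a) = counit a *: 1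
}.

Arguments comul {K h}.
Arguments counit {K h}.
Arguments antipode {K h}.

Section TensorForms.
Variable K : fieldType.

(* [K] carries no canonical vector space structure, unlike [K^o]. *)
Lemma eq_tliftK (U V : vectType K) (b b' : U -> V -> K^o) t :
  (forall u v, b u v = b' u v) -> tlift b t = tlift b' t :> K.
Proof. exact: eq_tlift. Qed.

Lemma bilin_mul (U V : vectType K) (f : {linear U -> K^o})
    (g : {linear V -> K^o}) : bilin (fun u v => f u * g v : K^o).
Proof.
split=> [v a u u' | u a v v']; rewrite linearP /=.
  by rewrite mulrDl /GRing.scale /= mulrA.
by rewrite mulrDr /GRing.scale /= mulrCA.
Qed.

Lemma bilin_scalel (U V : vectType K) (f : {linear U -> K^o}) :
  bilin (fun u (v : V) => f u *: v).
Proof.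
split=> [v a u u' | u a v v']; first by rewrite linearP /= scalerDl scalerA.
by rewrite scalerDr !scalerA mulrC.
Qed.

Lemma bilin_comp (U V U' V' W : vectType K) (b : U -> V -> W)
    (f : {linear U' -> U}) (g : {linear V' -> V}) :
  bilin b -> bilin (fun u v => b (f u) (g v)).
Proof.
move=> [linl linr].
by split=> [v a u u' | u a v v']; rewrite linearP ?linl ?linr.
Qed.

Lemma bilin_tliftr (U V U' : vectType K) (W : lmodType K)
    (b : U' -> U -> V -> W) :
  (forall x y, linear (fun u => b u x y)) -> bilin (fun u w => tlift (b u) w).
Proof.
move=> lb; split=> [w k u u'|u]; last exact: tlift_is_linear.
rewrite /tlift scaler_sumr -big_split; apply: eq_bigr => i _ /=.
rewrite scaler_sumr -big_split; apply: eq_bigr => j _ /=.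
by rewrite lb scalerDr !scalerA (mulrC k).
Qed.

Lemma bilin_tliftl (U V U' : vectType K) (W : lmodType K)
    (b : U -> V -> U' -> W) :
    (forall x y, linear (b x y)) ->
  bilin (fun w u => tlift (fun x y => b x y u) w).
Proof.
move=> lb; split=> [u|w k u u']; first exact: tlift_is_linear.
rewrite /tlift scaler_sumr -big_split; apply: eq_bigr => i _ /=.
rewrite scaler_sumr -big_split; apply: eq_bigr => j _ /=.
by rewrite lb scalerDr !scalerA (mulrC k).
Qed.

Lemma tensor_sep (U V : vectType K) (X Y : Type)
    (f : X -> {linear U -> K^o}) (g : Y -> {linear V -> K^o}) :
    (forall u, (forall x, f x u = 0) -> u = 0) ->
    (forall v, (forall y, g y v = 0) -> v = 0) ->
  forall s t : tensor U V,
    (forall x y, tlift (fun u v => f x u * g y v : K^o) s =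
                 tlift (fun u v => f x u * g y v : K^o) t) ->
  s = t.
Proof.
move=> sepf sepg s t eq_st; pose bf x y u v : K^o := f x u * g y v.
suff t0 (r : tensor U V) : (forall x y, tlift (bf x y) r = 0) -> r = 0.
  apply/eqP; rewrite -subr_eq0; apply/eqP; apply: t0 => x y.
  by rewrite linearB /= [X in X - _](eq_st x y) subrr.
move=> {s t eq_st} r0.
have part x : tlift (fun u v => f x u *: v) r = 0.
  apply: sepg => y; rewrite linear_tlift -[RHS](r0 x y); apply: eq_tlift => u v.
  by rewrite linearZ.
have {}part j : \sum_i (r : 'M_(_, _)) i j *: (vbasis {:U})`_i = 0.
  apply: sepf => x; move: (part x); rewrite /tlift exchange_big /=.
  move=> /(congr1 (coord (vbasis {:V}) j)); rewrite linear_sum linear0 /=.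
  rewrite (bigD1 j) //= [X in _ + X]big1 ?addr0.
    rewrite linear_sum /= => <-; rewrite linear_sum; apply: eq_bigr => i _.
    rewrite !linearZ /= coord_free ?(basis_free (vbasisP _)) // eqxx.
    by rewrite /GRing.scale /= mulr1.
  move=> k nkj; rewrite linear_sum /= big1 // => i _.
  rewrite !linearZ /= coord_free ?(basis_free (vbasisP _)) //.
  by rewrite (negPf nkj) /GRing.scale /= !mulr0.
apply/matrixP=> i j; rewrite [RHS]mxE.
by have /freeP/(_ _ (part j)) := basis_free (vbasisP {:U}).
Qed.

End TensorForms.

Local Ltac tlift_congr := first [apply: eq_tlift | apply: eq_tliftK].

Definition dual (K : fieldType) (A : hopfAlgebra K) : Type := 'Hom(A, K^o).

HB.instance Definition _ (K : fieldType) (A : hopfAlgebra K) :=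
  Vector.on (dual A).

Definition pairing (K : fieldType) (A : hopfAlgebra K) (f : dual A) (a : A) : K :=
  (f : 'Hom(A, K^o)) a.

Section Dual.
Variables (K : fieldType) (A : hopfAlgebra K).
Local Notation D := (dual A).
Implicit Types (f g h : D) (a b : A).

Lemma pairing_is_linear f : linear (pairing f : A -> K^o).
Proof. by move=> k a b; rewrite /pairing linearP. Qed.

HB.instance Definition _ f :=
  GRing.isLinear.Build K A K^o _ (pairing f) (pairing_is_linear f).

Definition eval a f : K^o := pairing f a.

Lemma eval_is_linear a : linear (eval a).
Proof. by move=> k f g; rewrite /eval /pairing add_lfunE scale_lfunE. Qed.

HB.instance Definition _ a :=
  GRing.isLinear.Build K D K^o _ (eval a) (eval_is_linear a).

Lemma dualP f g : (forall a, pairing f a = pairing g a) <-> f = g.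
Proof. by split=> [eqfg|-> //]; apply/lfunP => a; apply: eqfg. Qed.

Lemma pairingDl f g a : pairing (f + g) a = pairing f a + pairing g a.
Proof. by rewrite /pairing add_lfunE. Qed.

Lemma pairingZl k f a : pairing (k *: f) a = k * pairing f a.
Proof. by rewrite /pairing scale_lfunE. Qed.

Lemma pairing_tlift (U V : vectType K) f (b : U -> V -> A) t :
  pairing f (tlift b t) = tlift (fun u v => pairing f (b u v) : K^o) t.
Proof. exact: (linear_tlift (pairing f : {linear A -> K^o})). Qed.

Lemma pairing_tliftl (U V : vectType K) (b : U -> V -> D) t a :
  pairing (tlift b t) a = tlift (fun u v => pairing (b u v) a : K^o) t.
Proof. exact: (linear_tlift (eval a : {linear D -> K^o})). Qed.

(* The product of functionals is the transpose of the comultiplication: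
   <f g, a> = <f (x) g, comul a>. *)
Definition dual_mul f g : D :=
  linfun (tlift (fun x y => pairing f x * pairing g y : K^o) \o comul).

Definition dual_one : D := linfun counit.

Lemma dual_mulE f g a : pairing (dual_mul f g) a =
  tlift (fun x y => pairing f x * pairing g y : K^o) (comul a).
Proof. by rewrite /pairing lfunE. Qed.

Lemma dual_oneE a : pairing dual_one a = counit a.
Proof. by rewrite /pairing lfunE. Qed.

Lemma dual_mulA : associative dual_mul.
Proof.
move=> f g h; apply/dualP => a; rewrite !dual_mulE.
pose T3 (x y z : A) : K^o := pairing f x * (pairing g y * pairing h z).
have lin1 y z : linear (fun x => T3 x y z).
  by move=> k x x'; rewrite /T3 linearP /= mulrDl /GRing.scale /= !mulrA.
have lin2 x z : linear (fun y => T3 x y z).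
  move=> k y y'; rewrite /T3 linearP /= mulrDl mulrDr /GRing.scale /=.
  by rewrite -!mulrA (mulrCA _ k).
have lin3 x y : linear (T3 x y).
  by move=> k z z'; rewrite /T3 linearP /= !mulrDr /GRing.scale /= !(mulrCA _ k).
transitivity
    (tlift (fun x w => tlift (T3 x) w) (tmap id comul (comul a))).
  rewrite /tmap linear_tlift /=; tlift_congr => x y.
  rewrite tlift_tens /=; last exact: bilin_tliftr.
  rewrite dual_mulE /tlift mulr_sumr; apply: eq_bigr => i _.
  rewrite mulr_sumr; apply: eq_bigr => j _.
  by rewrite /T3 /GRing.scale /= mulrCA.
transitivity (tlift (fun w z => tlift (fun x y => T3 x y z) w)
    (tmap comul id (comul a))); last first.
  rewrite /tmap linear_tlift /=; tlift_congr => x y.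
  rewrite tlift_tens /=; last exact: bilin_tliftl.
  rewrite dual_mulE /tlift mulr_suml; apply: eq_bigr => i _.
  rewrite mulr_suml; apply: eq_bigr => j _.
  by rewrite /T3 /GRing.scale /= !mulrA.
rewrite -comulA; move: (tmap _ _ _) => t.
rewrite /tassoc linear_tlift /=; tlift_congr => w z.
rewrite linear_tlift /=; tlift_congr => x y.
rewrite tlift_tens; last exact: bilin_tliftr.
by rewrite tlift_tens.
Qed.

Lemma dual_mul1l : left_id dual_one dual_mul.
Proof.
move=> f; apply/dualP => a; rewrite dual_mulE -[in RHS](counitl a).
rewrite pairing_tlift; tlift_congr => x y.
by rewrite linearZ dual_oneE.
Qed.

Lemma dual_mul1r : right_id dual_one dual_mul.
Proof.
move=> f; apply/dualP => a; rewrite dual_mulE -[in RHS](counitr a).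
rewrite pairing_tlift; tlift_congr => x y.
by rewrite linearZ dual_oneE mulrC.
Qed.

Lemma dual_mulP k f g h : (dual_mul (k *: f + g) h = k *: dual_mul f h + dual_mul g h)
  * (dual_mul h (k *: f + g) = k *: dual_mul h f + dual_mul h g).
Proof.
split; apply/dualP => a; rewrite pairingDl pairingZl !dual_mulE;
  rewrite /tlift mulr_sumr -big_split; apply: eq_bigr => i _ /=;
  rewrite mulr_sumr -big_split; apply: eq_bigr => j _ /=;
  rewrite pairingDl pairingZl /GRing.scale /=.
  by rewrite mulrDl mulrDr (mulrCA k) !mulrA.
by rewrite !mulrDr !(mulrCA _ k).
Qed.

Lemma dual_mulDl : left_distributive dual_mul +%R.
Proof. by move=> f g h; rewrite -[f]scale1r dual_mulP !scale1r. Qed.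

Lemma dual_mulDr : right_distributive dual_mul +%R.
Proof. by move=> h f g; rewrite -[f]scale1r dual_mulP !scale1r. Qed.

Lemma dual_one_neq0 : dual_one != 0.
Proof.
apply/eqP=> /dualP/(_ 1); rewrite dual_oneE counit1 /pairing zero_lfunE.
by move/eqP; rewrite oner_eq0.
Qed.

HB.instance Definition _ := GRing.Zmodule_isNzRing.Build D
  dual_mulA dual_mul1l dual_mul1r dual_mulDl dual_mulDr dual_one_neq0.

Lemma dual_scaleAl k f g : k *: (f * g) = (k *: f) * g.
Proof.
have : (k *: f + 0) * g = k *: (f * g) + 0 * g := (dual_mulP k f 0 g).1.
by rewrite mul0r !addr0.
Qed.

HB.instance Definition _ := GRing.Lmodule_isLalgebra.Build K D dual_scaleAl.

Lemma dual_scaleAr k f g : k *: (f * g) = f * (k *: g).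
Proof.
have : f * (k *: g + 0) = k *: (f * g) + f * 0 := (dual_mulP k g 0 f).2.
by rewrite mulr0 !addr0.
Qed.

HB.instance Definition _ := GRing.Lalgebra_isAlgebra.Build K D dual_scaleAr.
HB.instance Definition _ := Algebra_isFalgebra.Build K D.

Lemma pairingM f g a : pairing (f * g) a =
  tlift (fun x y => pairing f x * pairing g y : K^o) (comul a).
Proof. exact: dual_mulE. Qed.

Lemma pairing1 a : pairing (1 : D) a = counit a.
Proof. exact: dual_oneE. Qed.

(* The identification of D (x) D with the space of bilinear forms on A. *)
Definition pairing2 (t : tensor D D) a b : K :=
  tlift (fun f g : D => pairing f a * pairing g b : K^o) t.

Lemma pairing2P (s t : tensor D D) :
  (forall a b, pairing2 s a b = pairing2 t a b) -> s = t.
Proof.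
apply: (@tensor_sep K D D A A (fun a => eval a : {linear D -> K^o})
   (fun a => eval a : {linear D -> K^o})) => f f0;
  by apply/dualP=> a; rewrite /pairing zero_lfunE; apply: f0.
Qed.

Lemma bilin_eval a b : bilin (fun f g : D => pairing f a * pairing g b : K^o).
Proof. exact: (bilin_mul (eval a) (eval b)). Qed.

Lemma pairing2_tens f g a b : pairing2 (tens f g) a b = pairing f a * pairing g b.
Proof. by rewrite /pairing2 tlift_tens //; exact: bilin_eval. Qed.

(* The comultiplication of the dual is the transpose of the multiplication of
   A, as stated by [pairing2_comul]. *)
Definition dual_comul f : tensor D D :=
  \sum_(i < \dim {:A}) \sum_(j < \dim {:A})
    pairing f ((vbasis {:A})`_i * (vbasis {:A})`_j) *:
    tens (linfun (coord (vbasis {:A}) i : A -> K^o) : D)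
         (linfun (coord (vbasis {:A}) j : A -> K^o) : D).

Lemma pairing2_comul f a b : pairing2 (dual_comul f) a b = pairing f (a * b).
Proof.
rewrite /pairing2 /dual_comul linear_sum.
rewrite {2}(coord_vbasis (memvf a)) mulr_suml linear_sum; apply: eq_bigr => i _.
rewrite {2}(coord_vbasis (memvf b)) mulr_sumr !linear_sum; apply: eq_bigr => j _.
rewrite linearZ /= tlift_tens; last exact: bilin_eval.
rewrite -scalerAl -scalerAr !linearZ /= /pairing !lfunE /=.
rewrite /GRing.scale /=; congr (_ * _); exact: mulrC.
Qed.

Lemma dual_comul_is_linear : linear dual_comul.
Proof.
move=> k f g; apply: pairing2P => a b.
rewrite pairing2_comul pairingDl pairingZl -!pairing2_comul.
by rewrite /pairing2 linearP.
Qed.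

HB.instance Definition _ :=
  GRing.isLinear.Build K D (tensor D D) _ dual_comul dual_comul_is_linear.

Definition dual_counit f : K^o := pairing f 1.

HB.instance Definition _ := GRing.Linear.copy dual_counit (eval 1).

Definition dual_antipode f : D := linfun ((pairing f : A -> K^o) \o antipode).

Lemma dual_antipodeE f a : pairing (dual_antipode f) a = pairing f (antipode a).
Proof. by rewrite /pairing lfunE. Qed.

Lemma dual_antipode_is_linear : linear dual_antipode.
Proof.
move=> k f g; apply/dualP=> a.
by rewrite dual_antipodeE !pairingDl !pairingZl !dual_antipodeE.
Qed.

HB.instance Definition _ :=
  GRing.isLinear.Build K D D _ dual_antipode dual_antipode_is_linear.

Lemma linear_pairing2 a b : linear (fun t => pairing2 t a b : K^o).
Proof. by move=> k s t; rewrite /pairing2 linearP. Qed.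

Lemma dual_comulA f :
  tassoc (tmap dual_comul id (dual_comul f)) = tmap id dual_comul (dual_comul f).
Proof.
pose ev2 (ab : A * A) : {linear tensor D D -> K^o} :=
  HB.pack (fun t => pairing2 t ab.1 ab.2 : K^o)
    (GRing.isLinear.Build K (tensor D D) K^o _ _ (linear_pairing2 ab.1 ab.2)).
pose ev a : {linear D -> K^o} := eval a.
apply: (tensor_sep (f := ev) (g := ev2)) => [g g0|t t0|a [b c]].
- by apply/dualP=> a; rewrite /pairing zero_lfunE; apply: g0.
- by apply: pairing2P => a b; rewrite -[LHS]/(ev2 (a, b) t) t0 /pairing2 linear0.
have b1 x q : bilin (fun u v => ev x u * ev2 q v : K^o) by exact: bilin_mul.
have b2 q x : bilin (fun u v => ev2 q u * ev x v : K^o) by exact: bilin_mul.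
transitivity (pairing f (a * b * c)); last first.
  rewrite -mulrA -pairing2_comul /pairing2 [RHS]linear_tlift /=.
  tlift_congr => g h; rewrite tlift_tens; last exact: (b1 a (b, c)).
  by rewrite /= pairing2_comul.
transitivity (tlift (fun u v => ev2 (a, b) u * ev c v : K^o)
   (tmap dual_comul id (dual_comul f))).
  rewrite linear_tlift /=; tlift_congr => t h.
  transitivity (tlift (fun g k : D =>
      pairing g a * pairing k b * pairing h c : K^o) t).
    rewrite linear_tlift /=; tlift_congr => g k.
    rewrite tlift_tens; last exact: (b1 a (b, c)).
    by rewrite /= pairing2_tens mulrA.
  rewrite /pairing2 /tlift mulr_suml; apply: eq_bigr => i _.
  rewrite mulr_suml; apply: eq_bigr => j _.
  by rewrite /GRing.scale /= !mulrA.
rewrite linear_tlift /= -pairing2_comul; tlift_congr => g h.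
rewrite tlift_tens; last exact: (b2 (a, b) c).
by rewrite /= pairing2_comul.
Qed.

Lemma dual_counitl f :
  tlift (fun g h : D => dual_counit g *: h) (dual_comul f) = f.
Proof.
apply/dualP=> a; rewrite pairing_tliftl -[in RHS](mul1r a).
rewrite -pairing2_comul; tlift_congr => g h.
by rewrite pairingZl.
Qed.

Lemma dual_counitr f :
  tlift (fun g h : D => dual_counit h *: g) (dual_comul f) = f.
Proof.
apply/dualP=> a; rewrite pairing_tliftl -[in RHS](mulr1 a).
rewrite -pairing2_comul; tlift_congr => g h.
by rewrite pairingZl mulrC.
Qed.

Lemma dual_comul1 : dual_comul (1 : D) = tens (1 : D) (1 : D).
Proof.
apply: pairing2P => a b.
by rewrite pairing2_comul pairing2_tens !pairing1 counitM.
Qed.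

Lemma tlift_mul (U V U' V' : vectType K) (b : U -> V -> K^o)
    (b' : U' -> V' -> K^o) s t :
  tlift b s * tlift b' t =
  tlift (fun u v => tlift (fun x y => b u v * b' x y : K^o) t) s.
Proof.
rewrite /tlift mulr_suml; apply: eq_bigr => i _.
rewrite mulr_suml; apply: eq_bigr => j _.
rewrite mulr_sumr scaler_sumr; apply: eq_bigr => k _.
rewrite mulr_sumr scaler_sumr; apply: eq_bigr => l _.
by rewrite /GRing.scale /= mulrACA !mulrA.
Qed.

Lemma pairing2_tmul (s t : tensor D D) a b :
  pairing2 (tmul s t) a b =
  tlift (fun x x' : A => tlift (fun y y' : A =>
    pairing2 s x y * pairing2 t x' y' : K^o) (comul b)) (comul a).
Proof.
pose F (f g h l : D) (x x' y y' : A) : K^o :=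
  (pairing f x * pairing g y) * (pairing h x' * pairing l y').
transitivity (tlift (fun x x' => tlift (fun y y' => tlift (fun f g =>
    tlift (fun h l => F f g h l x x' y y') t) s) (comul b)) (comul a));
  last first.
  by tlift_congr => x x'; tlift_congr => y y'; rewrite tlift_mul.
under eq_tlift => x x' do rewrite tlift_exchange.
rewrite tlift_exchange {1}/pairing2 /tmul linear_tlift /=.
tlift_congr => f g.
under [RHS]eq_tlift => x x' do rewrite tlift_exchange.
rewrite tlift_exchange linear_tlift /=.
tlift_congr => h l.
rewrite tlift_tens; last exact: bilin_eval.
rewrite !pairingM tlift_mul.
tlift_congr => x x'; tlift_congr => y y'.
by rewrite /F mulrACA.
Qed.

Lemma dual_comulM f g : dual_comul (f * g) = tmul (dual_comul f) (dual_comul g).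
Proof.
apply: pairing2P => a b; rewrite pairing2_comul pairingM comulM pairing2_tmul.
rewrite /tmul linear_tlift /=; tlift_congr => x x'.
rewrite linear_tlift /=; tlift_congr => y y'.
by rewrite tlift_tens ?pairing2_comul //; exact: bilin_mul.
Qed.

Lemma dual_counit1 : dual_counit (1 : D) = 1.
Proof. by rewrite /dual_counit pairing1 counit1. Qed.

Lemma dual_counitM f g : dual_counit (f * g) = dual_counit f * dual_counit g.
Proof.
by rewrite /dual_counit pairingM comul1 tlift_tens //; exact: bilin_mul.
Qed.

Lemma dual_antipodel f :
  tlift (fun g h : D => dual_antipode g * h) (dual_comul f) = dual_counit f *: 1.
Proof.
apply/dualP=> a; rewrite pairingZl pairing1 mulrC.
rewrite pairing_tliftl.
under eq_tlift => g h do rewrite pairingM.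
have -> : counit a * dual_counit f = pairing f (counit a *: 1).
  by rewrite linearZ.
rewrite tlift_exchange.
rewrite -antipodel pairing_tlift; tlift_congr => x y.
rewrite -pairing2_comul; tlift_congr => g h.
by rewrite dual_antipodeE.
Qed.

Lemma dual_antipoder f :
  tlift (fun g h : D => g * dual_antipode h) (dual_comul f) = dual_counit f *: 1.
Proof.
apply/dualP=> a; rewrite pairingZl pairing1 mulrC.
rewrite pairing_tliftl.
under eq_tlift => g h do rewrite pairingM.
have -> : counit a * dual_counit f = pairing f (counit a *: 1).
  by rewrite linearZ.
rewrite tlift_exchange.
rewrite -antipoder pairing_tlift; tlift_congr => x y.
rewrite -pairing2_comul; tlift_congr => g h.
by rewrite dual_antipodeE.
Qed.

Definition dual_hopf : hopfAlgebra K := HopfAlgebra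
  dual_comulA dual_counitl dual_counitr dual_comul1 dual_comulM
  dual_counit1 dual_counitM dual_antipodel dual_antipoder.

End Dual.

Definition group_alg (K : fieldType) (gT : finGroupType) : Type :=
  {ffun gT -> K^o}.

HB.instance Definition _ (K : fieldType) (gT : finGroupType) :=
  Vector.on (group_alg K gT).

Section GroupAlgebra.
Variables (K : fieldType) (gT : finGroupType).
Local Notation KG := (group_alg K gT).
Implicit Types (a b c : KG) (g h : gT).

Definition coef a g : K := (a : {ffun gT -> K^o}) g.

Definition gelt g : KG := [ffun h => (h == g)%:R].

Lemma group_algP a b : (forall g, coef a g = coef b g) <-> a = b.
Proof. by split=> [eqab|-> //]; apply/ffunP. Qed.

Lemma coefP k a b g : coef (k *: a + b) g = k * coef a g + coef b g.
Proof. by rewrite /coef !ffunE. Qed.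

Lemma coefD a b g : coef (a + b) g = coef a g + coef b g.
Proof. by rewrite /coef !ffunE. Qed.

Lemma coefZ k a g : coef (k *: a) g = k * coef a g.
Proof. by rewrite /coef !ffunE. Qed.

Lemma coef_gelt g h : coef (gelt g) h = (h == g)%:R.
Proof. by rewrite /coef ffunE. Qed.

Definition group_alg_mul a b : KG :=
  [ffun g => \sum_h coef a h * coef b (h^-1 * g)%g].

Lemma coef_mul a b g :
  coef (group_alg_mul a b) g = \sum_h coef a h * coef b (h^-1 * g)%g.
Proof. by rewrite {1}/coef ffunE. Qed.

Lemma group_alg_mulA : associative group_alg_mul.
Proof.
move=> a b c; apply/group_algP => g; rewrite !coef_mul.
under [RHS]eq_bigr => l _ do rewrite coef_mul mulr_suml.
rewrite exchange_big; apply: eq_bigr => h _ /=.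
rewrite coef_mul mulr_sumr (reindex_inj (mulgI h^-1)%g) /=.
apply: eq_bigr => l _; rewrite mulrA; congr (_ * coef c _).
by rewrite invMg invgK -mulgA mulKVg.
Qed.

Lemma group_alg_mul1l : left_id (gelt 1%g) group_alg_mul.
Proof.
move=> a; apply/group_algP => g; rewrite coef_mul (bigD1 1%g) //=.
rewrite coef_gelt eqxx mul1r invg1 mul1g big1 ?addr0 // => h nh1.
by rewrite coef_gelt (negPf nh1) mul0r.
Qed.

Lemma group_alg_mul1r : right_id (gelt 1%g) group_alg_mul.
Proof.
move=> a; apply/group_algP => g; rewrite coef_mul (bigD1 g) //=.
rewrite mulVg coef_gelt eqxx mulr1 big1 ?addr0 // => h nhg.
rewrite coef_gelt -(inj_eq (mulgI h)) mulKVg mulg1 eq_sym (negPf nhg).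
by rewrite mulr0.
Qed.

Lemma group_alg_mulDl : left_distributive group_alg_mul +%R.
Proof.
move=> a b c; apply/group_algP => g; rewrite coefD !coef_mul -big_split.
by apply: eq_bigr => h _; rewrite coefD mulrDl.
Qed.

Lemma group_alg_mulDr : right_distributive group_alg_mul +%R.
Proof.
move=> a b c; apply/group_algP => g; rewrite coefD !coef_mul -big_split.
by apply: eq_bigr => h _; rewrite coefD mulrDr.
Qed.

Lemma group_alg_1neq0 : gelt 1%g != 0.
Proof.
apply/eqP => /group_algP/(_ 1%g); rewrite coef_gelt eqxx /coef ffunE.
by move/eqP; rewrite oner_eq0.
Qed.

HB.instance Definition _ := GRing.Zmodule_isNzRing.Build KG group_alg_mulA
  group_alg_mul1l group_alg_mul1r group_alg_mulDl group_alg_mulDr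
  group_alg_1neq0.

Lemma group_alg_scaleAl k a b : k *: (a * b) = (k *: a) * b.
Proof.
apply/group_algP => g; rewrite coefZ !coef_mul mulr_sumr.
by apply: eq_bigr => h _; rewrite coefZ mulrA.
Qed.

HB.instance Definition _ :=
  GRing.Lmodule_isLalgebra.Build K KG group_alg_scaleAl.

Lemma group_alg_scaleAr k a b : k *: (a * b) = a * (k *: b).
Proof.
apply/group_algP => g; rewrite coefZ !coef_mul mulr_sumr.
by apply: eq_bigr => h _; rewrite coefZ mulrCA.
Qed.

HB.instance Definition _ :=
  GRing.Lalgebra_isAlgebra.Build K KG group_alg_scaleAr.
HB.instance Definition _ := Algebra_isFalgebra.Build K KG.

Lemma gelt1 : gelt 1%g = 1. Proof. by []. Qed.

Lemma geltM g h : gelt g * gelt h = gelt (g * h)%g.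
Proof.
apply/group_algP => k; rewrite coef_mul (bigD1 g) //= big1 ?addr0 => [|l nlg].
  by rewrite !coef_gelt eqxx mul1r -(inj_eq (mulgI g)) mulKVg.
by rewrite !coef_gelt (negPf nlg) mul0r.
Qed.

Definition gext (W : lmodType K) (u : gT -> W) a : W := \sum_g coef a g *: u g.

Lemma gext_is_linear (W : lmodType K) (u : gT -> W) : linear (gext u).
Proof.
move=> k a b; rewrite scaler_sumr -big_split; apply: eq_bigr => g _ /=.
by rewrite coefP scalerDl scalerA.
Qed.

HB.instance Definition _ (W : lmodType K) (u : gT -> W) :=
  GRing.isLinear.Build K KG W _ (gext u) (gext_is_linear u).

Lemma gext_gelt (W : lmodType K) (u : gT -> W) g : gext u (gelt g) = u g.
Proof.
rewrite /gext (bigD1 g) //= coef_gelt eqxx scale1r big1 ?addr0 // => h nhg.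
by rewrite coef_gelt (negPf nhg) scale0r.
Qed.

Lemma gext_id a : gext gelt a = a.
Proof.
apply/group_algP => g; rewrite /gext /coef sum_ffunE (bigD1 g) //=.
rewrite big1 => [|h nhg]; rewrite !ffunE ?eqxx /GRing.scale /=.
  by rewrite mulr1 addr0.
by rewrite eq_sym (negPf nhg) mulr0.
Qed.

Lemma gelt_ind (P : KG -> Prop) :
    (forall g, P (gelt g)) -> (forall k a b, P a -> P b -> P (k *: a + b)) ->
  forall a, P a.
Proof.
move=> Pg PD a.
have P0 : P 0 by move: (PD (-1) _ _ (Pg 1%g) (Pg 1%g)); rewrite scaleN1r addNr.
rewrite -(gext_id a) /gext; elim/big_rec: _ => // g b _ Pb; exact: PD.
Qed.

Lemma gelt_linear (W : lmodType K) (u v : {linear KG -> W}) :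
  (forall g, u (gelt g) = v (gelt g)) -> u =1 v.
Proof.
move=> eq_uv; elim/gelt_ind => // k a b eqa eqb.
by rewrite !linearP eqa eqb.
Qed.

Definition group_comul : KG -> tensor KG KG :=
  gext (fun g => tens (gelt g) (gelt g)).
Definition group_counit : KG -> K^o := gext (fun=> 1 : K^o).
Definition group_antipode : KG -> KG := gext (fun g => gelt g^-1%g).

HB.instance Definition _ := GRing.Linear.on group_comul.
HB.instance Definition _ := GRing.Linear.on group_counit.
HB.instance Definition _ := GRing.Linear.on group_antipode.

Lemma group_comulE g : group_comul (gelt g) = tens (gelt g) (gelt g).
Proof. exact: gext_gelt. Qed.

Lemma group_counitE g : group_counit (gelt g) = 1.
Proof. exact: gext_gelt. Qed.

Lemma group_antipodeE g : group_antipode (gelt g) = gelt g^-1%g.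
Proof. exact: gext_gelt. Qed.

Lemma bilin_mulA (A : falgType K) : bilin (fun x y : A => x * y).
Proof.
split=> [z k x y|z k x y]; first by rewrite mulrDl scalerAl.
by rewrite mulrDr scalerAr.
Qed.

Lemma group_comulA a : tassoc (tmap group_comul id (group_comul a)) =
  tmap id group_comul (group_comul a).
Proof.
rewrite /tassoc /tmap; elim/gelt_ind: a => [g|k a b IHa IHb]; last first.
  by rewrite !linearP /= IHa IHb.
have bt (U V : vectType K) : bilin (@tens K U V) by exact: bilin_tens.
rewrite group_comulE tlift_tens; last exact: (bilin_comp group_comul idfun).
rewrite [RHS]tlift_tens; last exact: (bilin_comp idfun group_comul).
rewrite group_comulE tlift_tens; last first.
  apply: bilin_tliftl => x y k z z'.
  by rewrite (bt _ _).2 (bt _ _).2.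
rewrite tlift_tens //; split=> [y k x x'|x k y y']; first exact: (bt _ _).1.
by rewrite (bt _ _).1 (bt _ _).2.
Qed.

Lemma group_counitl a :
  tlift (fun x y => group_counit x *: y) (group_comul a) = a.
Proof.
elim/gelt_ind: a => [g|k a b IHa IHb]; last by rewrite !linearP /= IHa IHb.
rewrite group_comulE tlift_tens; last exact: bilin_scalel.
by rewrite group_counitE scale1r.
Qed.

Lemma group_counitr a :
  tlift (fun x y => group_counit y *: x) (group_comul a) = a.
Proof.
elim/gelt_ind: a => [g|k a b IHa IHb]; last by rewrite !linearP /= IHa IHb.
rewrite group_comulE tlift_tens; first by rewrite group_counitE scale1r.
have [lin1 lin2] := bilin_scalel KG group_counit.
by split=> u; [apply: lin2|apply: lin1].
Qed.

Lemma group_comul1 : group_comul 1 = tens 1 1.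
Proof. by rewrite -gelt1 group_comulE. Qed.

Lemma bilin_tmul (A : falgType K) : bilin (@tmul K A).
Proof. by apply: bilin_tliftl => x y; exact: tlift_is_linear. Qed.

Lemma tmul_tens (A : falgType K) (a b c d : A) :
  tmul (tens a b) (tens c d) = tens (a * c) (b * d).
Proof.
have bt : bilin (@tens K A A) by exact: bilin_tens.
rewrite /tmul tlift_tens; last first.
  split=> [y|x].
    apply: (bilin_tliftr _).1 => u v k x x'.
    by rewrite mulrDl -scalerAl bt.1.
  apply: (bilin_tliftr _).1 => u v k y y'.
  by rewrite mulrDl -scalerAl bt.2.
rewrite tlift_tens //; split=> [v k u u'|u k v v'].
  by rewrite mulrDr -scalerAr bt.1.
by rewrite mulrDr -scalerAr bt.2.
Qed.

Lemma group_comulM a b :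
  group_comul (a * b) = tmul (group_comul a) (group_comul b).
Proof.
elim/gelt_ind: a => [g|k a a' IHa IHa']; last first.
  by rewrite mulrDl -scalerAl !linearP /= IHa IHa' (bilin_tmul KG).1.
elim/gelt_ind: b => [h|k b b' IHb IHb']; last first.
  by rewrite mulrDr -scalerAr !linearP /= IHb IHb' (bilin_tmul KG).2.
by rewrite geltM !group_comulE tmul_tens !geltM.
Qed.

Lemma group_counit1 : group_counit 1 = 1.
Proof. by rewrite -gelt1 group_counitE. Qed.

Lemma group_counitM a b :
  group_counit (a * b) = group_counit a * group_counit b.
Proof.
elim/gelt_ind: a => [g|k a a' IHa IHa']; last first.
  by rewrite mulrDl -scalerAl !linearP /= IHa IHa' mulrDl scalerAl.
elim/gelt_ind: b => [h|k b b' IHb IHb']; last first.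
  by rewrite mulrDr -scalerAr !linearP /= IHb IHb' mulrDr scalerAr.
by rewrite geltM !group_counitE mulr1.
Qed.

Lemma group_antipodel a :
  tlift (fun x y => group_antipode x * y) (group_comul a) = group_counit a *: 1.
Proof.
elim/gelt_ind: a => [g|k a b IHa IHb]; last first.
  by rewrite !linearP /= IHa IHb scalerDl scalerA.
rewrite group_comulE tlift_tens.
  by rewrite group_antipodeE geltM mulVg group_counitE scale1r.
exact: (bilin_comp group_antipode idfun (bilin_mulA KG)).
Qed.

Lemma group_antipoder a :
  tlift (fun x y => x * group_antipode y) (group_comul a) = group_counit a *: 1.
Proof.
elim/gelt_ind: a => [g|k a b IHa IHb]; last first.
  by rewrite !linearP /= IHa IHb scalerDl scalerA.
rewrite group_comulE tlift_tens.
  by rewrite group_antipodeE geltM mulgV group_counitE scale1r.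
exact: (bilin_comp idfun group_antipode (bilin_mulA KG)).
Qed.

Definition group_hopf : hopfAlgebra K := HopfAlgebra
  group_comulA group_counitl group_counitr group_comul1 group_comulM
  group_counit1 group_counitM group_antipodel group_antipoder.

End GroupAlgebra.

Section Orders.
Variables (K : fieldType) (R : set K).

Definition is_subalg (A : algType K) (H : set A) : Prop :=
  [/\ H 1,
      forall x y, H x -> H y -> H (x - y),
      forall x y, H x -> H y -> H (x * y)
    & forall r x, R r -> H x -> H (r *: x)].

Definition gen_subalg (A : algType K) (X : set A) : set A :=
  smallest (@is_subalg A) X.

Definition rspan (V : lmodType K) (n : nat) (e : n.-tuple V) : set V :=
  [set x | exists r : 'I_n -> K,
             (forall i, R (r i)) /\ x = \sum_i r i *: tnth e i]%classic.

(* The image of H (x)_R H in B (x)_K B. *)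
Definition tensor_square (B : vectType K) (H : set B) : set (tensor B B) :=
  [set t | exists s : seq (B * B),
             (forall u, u \in s -> H u.1 /\ H u.2) /\
             t = \sum_(u <- s) tens u.1 u.2]%classic.

(* H is free of finite rank over R on some family e, and the natural map from
   K (x)_R H, which has K-basis (1 (x) e_i), to B is bijective: together, e is
   a K-basis of B whose R-span is H. In particular H (x)_R H embeds in
   B (x)_K B, and H is a Hopf algebra over R for the operations induced from B
   as soon as it is stable under them. *)
Definition hopf_order (B : hopfAlgebra K) (H : set B) : Prop :=
  [/\ is_subalg H,
      exists e : (\dim {:B}).-tuple B, basis_of {:B} e /\ H = rspan e,
      forall x, H x -> tensor_square H (comul x),
      forall x, H x -> R (counit x)
    & forall x, H x -> H (antipode x)].

End Orders.

Section Valuation.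
Variables (K : fieldType) (nu : K -> \bar int).

Definition discrete_valuation : Prop :=
  [/\ forall x, nu x <> -oo%E,
      forall x, nu x = +oo%E <-> x = 0,
      forall x y, nu (x * y) = (nu x + nu y)%E
    & forall x y, (Order.min (nu x) (nu y) <= nu (x + y))%E].

Definition valuation_complete : Prop :=
  forall u : nat -> K,
    (forall N : int, exists n0 : nat, forall m n : nat,
       (n0 <= m)%N -> (n0 <= n)%N -> (N%:E <= nu (u m - u n))%E) ->
  exists l : K,
    forall N : int, exists n0 : nat, forall n : nat,
       (n0 <= n)%N -> (N%:E <= nu (u n - l))%E.

Definition valuation_ring : set K := [set x | (0 <= nu x)%E]%classic.

End Valuation.

Definition wp (K : fieldType) (p : nat) (x : K) : K := x ^+ p - x.

Definition dual_monomial (K : fieldType) (gT : finGroupType) (p : nat)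
    (g1 g2 g3 : gT) (a b c : nat) (xi : dual (group_hopf K gT)) : Prop :=
  forall j k l : nat, (j < p)%N -> (k < p)%N -> (l < p)%N ->
    pairing xi ((gelt K g1 - 1) ^+ j * (gelt K g2 - 1) ^+ k
                * (gelt K g3 - 1) ^+ l : group_alg K gT)
    = (a == j)%:R * (b == k)%:R * (c == l)%:R.

(* Main.v *)
Require Import Defs.
From HB Require Import structures.
From mathcomp Require Import all_boot all_order all_algebra all_fingroup.
From mathcomp Require Import all_solvable all_field.
From mathcomp Require Import classical_sets constructive_ereal.
From mathcomp Require Import zify ring.

Set Implicit Arguments.
Unset Strict Implicit.
Unset Printing Implicit Defensive.

Import Order.TTheory GRing.Theory Num.Theory.

Local Open Scope ring_scope.

(** The K-linear dual of K[G] is the algebra of functions from G to K under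
    pointwise multiplication ([fvalM]), and its primitive elements are the
    additive characters of G ([comul_additive_char]).  Write g in G as
    g1^j g2^k g3^l.  The three given functionals are the coordinate characters
    g |-> j, k, l, because (1 + (g - 1))^j has binomial coefficients
    ([dual_monomial_linear]).

    The three generators x_1, x_2, x_3 of the order are K-combinations of
    additive characters, hence additive characters, and the change of
    coordinates is triangular with nonzero diagonal, so they still separate the
    points of G.  A coordinate character xi satisfies xi^p = xi, so the
    Frobenius gives

      x_1^p = pi^(p i1) (xi_1 - mu^p xi_2 - alpha^p xi_3)
            = pi^(p i1 - i1) x_1 - pi^(p i1 - i2) wp(mu) x_2
              - pi^(p i1 - i3) (wp(alpha) + wp(mu) beta) x_3

    and likewise x_2^p = pi^(p i2 - i2) x_2 - pi^(p i2 - i3) wp(beta) x_3 and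
    x_3^p = pi^(p i3 - i3) x_3.  The three hypotheses on valuations say
    exactly that the coefficients involving mu, alpha and beta lie in R, and the
    powers pi^(p i - i) do because i >= 0.

    These relations suffice ([hopf_order_additive_chars]).  Since each x_i^p is
    an R-linear form in the x_j, every monomial can be rewritten through
    monomials with exponents below p, the total degree dropping at each step;
    so the p^3 reduced monomials span R[x_1, x_2, x_3] over R
    ([gen_subalg_red_monom]).  The same statement with K in place of R shows
    that they span a K-subalgebra of functions that separates the points of the
    finite set G, that is, all functions on G ([separating_subalg]).  As the
    dual has dimension #|G| = p^3, they form a K-basis.  Finally the
    comultiplication, the counit and the antipode are algebra maps sending x_i
    to x_i (x) 1 + 1 (x) x_i, 0 and - x_i, so they preserve the order. *)

(** * Linear combinations with coefficients in a subring *)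

Definition subring_set (K : fieldType) (R : set K) : Prop :=
  [/\ R 1, forall x y, R x -> R y -> R (x - y)
    & forall x y, R x -> R y -> R (x * y)].

Definition lincomb (K : fieldType) (R : set K) (V : lmodType K) (I : finType)
    (e : I -> V) : set V :=
  [set x | exists2 r : I -> K, forall i, R (r i) &
             x = \sum_i r i *: e i]%classic.

Section LinearCombinations.
Variables (K : fieldType) (R : set K).
Hypothesis R_subring : subring_set R.

Lemma subring_set0 : R 0.
Proof. by case: R_subring => R1 RB _; rewrite -(subrr 1); apply: RB. Qed.

Lemma subring_setN x : R x -> R (- x).
Proof.
case: R_subring => _ RB _ Rx; rewrite -sub0r.
by apply: RB => //; apply: subring_set0.
Qed.

Lemma subring_setD x y : R x -> R y -> R (x + y).
Proof.
case: R_subring => _ RB _ Rx Ry; rewrite -[y]opprK.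
by apply: RB => //; apply: subring_setN.
Qed.

Section Span.
Variables (V : lmodType K) (I : finType) (e : I -> V).
Local Notation S := (lincomb R e).

Lemma lincomb_gen i : S (e i).
Proof.
have [R1 _ _] := R_subring.
exists (fun j => (j == i)%:R) => [j|].
  by case: eqP => // _; apply: subring_set0.
rewrite (bigD1 i) //= eqxx scale1r big1 ?addr0 // => j /negPf ->.
by rewrite scale0r.
Qed.

Lemma lincombD x y : S x -> S y -> S (x + y).
Proof.
move=> [r Rr ->] [s Rs ->]; exists (fun i => r i + s i) => [i|].
  exact: subring_setD.
by rewrite -big_split; apply: eq_bigr => i _; rewrite scalerDl.
Qed.

Lemma lincombZ k x : R k -> S x -> S (k *: x).
Proof.
have [_ _ RM] := R_subring.
move=> Rk [r Rr ->]; exists (fun i => k * r i) => [i|]; first exact: RM.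
by rewrite scaler_sumr; apply: eq_bigr => i _; rewrite scalerA.
Qed.

Lemma lincombB x y : S x -> S y -> S (x - y).
Proof.
move=> Sx Sy; apply: lincombD => //; rewrite -scaleN1r; apply: lincombZ => //.
by apply: subring_setN; case: R_subring.
Qed.

Lemma lincomb_sum (J : finType) (F : J -> V) :
  (forall j, S (F j)) -> S (\sum_j F j).
Proof.
move=> SF; elim/big_ind: _ => //; last exact: lincombD.
exists (fun=> 0) => [i|]; first exact: subring_set0.
by rewrite big1 // => i _; rewrite scale0r.
Qed.
End Span.

Lemma is_subalg_sum (A : algType K) (H : set A) (J : finType) (F : J -> A) :
  is_subalg R H -> (forall j, H (F j)) -> H (\sum_j F j).
Proof.
case=> H1 subH _ _ HF.
have H0 : H 0 by rewrite -(subrr 1); apply: subH.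
elim/big_ind: _ => // x y Hx Hy.
by rewrite -[y]opprK; apply: (subH) => //; rewrite -sub0r; apply: subH.
Qed.

End LinearCombinations.

Lemma is_subalg_exp (K : fieldType) (R : set K) (A : algType K) (H : set A)
    x n :
  is_subalg R H -> H x -> H (x ^+ n).
Proof.
case=> H1 _ HM _ Hx; elim: n => [|n IHn]; first by rewrite expr0.
by rewrite exprS; apply: HM.
Qed.

Lemma is_subalg_prod (K : fieldType) (R : set K) (A : algType K) (H : set A)
    (J : Type) (s : seq J) (P : pred J) (F : J -> A) :
  is_subalg R H -> (forall j, P j -> H (F j)) -> H (\prod_(j <- s | P j) F j).
Proof. by case=> H1 _ HM _ HF; elim/big_ind: _. Qed.

(** Bridges the spans indexed by an arbitrary finite type, convenient for
    exponent vectors, and those indexed by tuples in [hopf_order]. *)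
Lemma rspan_image (K : fieldType) (R : set K) (V : lmodType K) (I : finType)
    (f : I -> V) n (e : n.-tuple V) :
  e = [seq f i | i <- enum I] :> seq V -> rspan R e = lincomb R f.
Proof.
move=> def_e; have def_n : n = #|I|.
  by rewrite cardE -(size_map f) -def_e size_tuple.
subst n; have tnthE i : tnth e i = f (enum_val i).
  rewrite (tnth_nth (f (enum_val i))) def_e.
  by rewrite (nth_map (enum_val i)) -?enum_val_nth -?cardE.
have reindexI (F : I -> V) : \sum_i F i = \sum_(i < #|I|) F (enum_val i).
  by apply: reindex; apply: onW_bij; apply: enum_val_bij.
apply/seteqP; split=> x [r].
  case=> Rr ->; exists (r \o enum_rank) => [i|]; first exact: Rr.
  by rewrite reindexI; apply: eq_bigr => i _; rewrite /= enum_valK tnthE.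
move=> Rr ->; exists (r \o enum_val); split=> [i|]; first exact: Rr.
by rewrite reindexI; apply: eq_bigr => i _; rewrite /= tnthE.
Qed.

(** * Subalgebras spanned by reduced monomials *)

Section Monomials.
Variables (K : fieldType) (A : comAlgType K) (n p : nat) (x : 'I_n -> A).

Definition monom (m : 'I_n -> nat) : A := \prod_i x i ^+ m i.

Definition red_monom (m : {ffun 'I_n -> 'I_p}) : A := monom (fun i => m i).

Lemma eq_monom m m' : m =1 m' -> monom m = monom m'.
Proof. by move=> eq_m; apply: eq_bigr => i _; rewrite eq_m. Qed.

Lemma monomD m m' : monom m * monom m' = monom (fun i => m i + m' i)%N.
Proof. by rewrite /monom -big_split; apply: eq_bigr => i _; rewrite exprD. Qed.

Lemma monom0 : monom (fun=> 0%N) = 1.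
Proof. by rewrite /monom big1. Qed.

Lemma monomX i k : monom (fun j => (j == i) * k)%N = x i ^+ k.
Proof.
rewrite /monom (bigD1 i) //= eqxx mul1n big1 ?mulr1 // => j /negPf ->.
by rewrite mul0n expr0.
Qed.

Variable R : set K.
Hypothesis R_subring : subring_set R.
Hypothesis p_gt1 : (1 < p)%N.
Hypothesis xp_lincomb : forall i, lincomb R x (x i ^+ p).

(** Replacing a factor [x i ^+ p] by a linear form lowers the total degree by
    [p - 1 > 0], so the rewriting stops, and it stops at reduced monomials. *)
Lemma lincomb_monom m : lincomb R red_monom (monom m).
Proof.
have [d] := ubnP (\sum_i m i)%N; elim: d m => // d IHd m le_md.
have [/forallP lt_mp|] := boolP [forall i, m i < p]%N.
  have -> : monom m = red_monom [ffun i => Ordinal (lt_mp i)].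
    by apply: eq_monom => i; rewrite ffunE.
  exact: lincomb_gen.
rewrite negb_forall => /existsP[i]; rewrite -leqNgt => le_pm.
pose m' j := (m j - (j == i) * p)%N.
have mE j : m j = (m' j + (j == i) * p)%N.
  by rewrite /m'; case: (j =P i) => [->|_]; lia.
rewrite (eq_monom mE) -monomD monomX.
have [c Rc ->] := xp_lincomb i.
rewrite mulr_sumr; apply: lincomb_sum => // j.
rewrite -scalerAr; apply: lincombZ => //.
rewrite -[x j]expr1 -monomX monomD; apply: IHd.
have sum_delta k q : (\sum_j (j == k) * q = q)%N.
  by rewrite (bigD1 k) //= eqxx mul1n big1 ?addn0 // => l /negPf ->.
move: le_md; rewrite (eq_bigr _ (fun j _ => mE j)) !big_split /= !sum_delta.
lia.
Qed.

Lemma is_subalg_red_monom : is_subalg R (lincomb R red_monom).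
Proof.
split=> [|u v|u v|k u]; last exact: lincombZ.
- by rewrite -monom0; apply: lincomb_monom.
- exact: lincombB.
move=> [r Rr ->] [s Rs ->]; rewrite mulr_suml; apply: lincomb_sum => // i.
rewrite mulr_sumr; apply: lincomb_sum => // j.
rewrite -scalerAl -scalerAr; apply: lincombZ => //; apply: lincombZ => //.
by rewrite monomD; apply: lincomb_monom.
Qed.

Lemma red_monom_gen i : lincomb R red_monom (x i).
Proof. by rewrite -[x i]expr1 -monomX; apply: lincomb_monom. Qed.

Lemma gen_subalg_red_monom :
  gen_subalg R [set x i | i in [set: 'I_n]]%classic = lincomb R red_monom.
Proof.
apply/seteqP; split=> u.
  apply; split=> [|_ [i _ <-]]; first exact: is_subalg_red_monom.
  exact: red_monom_gen.
move=> [r Rr ->] H [H_subalg xH]; apply: (is_subalg_sum H_subalg) => m.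
have [_ _ _ HZ] := H_subalg; apply: HZ => //.
rewrite /red_monom /monom; apply: (is_subalg_prod _ H_subalg) => i _.
apply: (is_subalg_exp _ H_subalg).
by apply: xH; exists i.
Qed.

End Monomials.

(** * The dual of a group algebra as an algebra of functions *)

Section FunctionAlgebra.
Variables (K : fieldType) (gT : finGroupType).
Local Notation D := (dual (group_hopf K gT)).
Implicit Types (f : D) (g h : gT).

Definition fval f g : K := pairing f (gelt K g).

Lemma fval_inj f f' : fval f =1 fval f' -> f = f'.
Proof.
move=> eq_ff'; apply/dualP.
exact: (gelt_linear (u := pairing f : {linear group_hopf K gT -> K^o})
  (v := pairing f')).
Qed.

Lemma fvalD f f' g : fval (f + f') g = fval f g + fval f' g.
Proof. exact: pairingDl. Qed.

Lemma fvalZ k f g : fval (k *: f) g = k * fval f g.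
Proof. exact: pairingZl. Qed.

Lemma fvalB f f' g : fval (f - f') g = fval f g - fval f' g.
Proof. by rewrite fvalD -scaleN1r fvalZ mulN1r. Qed.

Lemma fval_sum (I : finType) (F : I -> D) g :
  fval (\sum_i F i) g = \sum_i fval (F i) g.
Proof.
apply: (big_morph (fval^~ g)) => [f f'|]; first exact: fvalD.
by rewrite -(scale0r 0) fvalZ mul0r.
Qed.

Lemma fval1 g : fval 1 g = 1.
Proof. by rewrite /fval pairing1; exact: group_counitE. Qed.

Lemma fvalM f f' g : fval (f * f') g = fval f g * fval f' g.
Proof.
rewrite /fval pairingM /= group_comulE tlift_tens //.
exact: (bilin_mul (pairing f : {linear _ -> K^o}) (pairing f')).
Qed.

Lemma fvalX f n g : fval (f ^+ n) g = fval f g ^+ n.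
Proof. by elim: n => [|n IHn]; rewrite ?expr0 ?fval1 // !exprS fvalM IHn. Qed.

Lemma dual_mulC : commutative (@GRing.mul D).
Proof. by move=> f f'; apply: fval_inj => g; rewrite !fvalM mulrC. Qed.

HB.instance Definition _ := GRing.PzRing_hasCommutativeMul.Build D dual_mulC.

Lemma dim_dual : \dim {:D} = #|gT|.
Proof. by rewrite dimvf /dim /= /dim /= !muln1. Qed.

Lemma counit_fval f : counit (f : dual_hopf (group_hopf K gT)) = fval f 1%g.
Proof. by []. Qed.

Lemma fval_antipode f g :
  fval (antipode (f : dual_hopf (group_hopf K gT))) g = fval f g^-1%g.
Proof. by rewrite /fval /= dual_antipodeE /= group_antipodeE. Qed.

Section Separation.
Variable S : set D.
Hypothesis S_subalg : is_subalg setT S.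
Hypothesis S_sep : forall g h, g != h -> exists2 f, S f & fval f g != fval f h.

(** If [f] separates [g] from [h], an affine function of [f] is 1 at [g] and 0
    at [h]; the product of these over all [h] is the indicator of [g]. *)
Lemma separating_indicator g :
  exists2 u, S u & forall h, fval u h = (h == g)%:R.
Proof.
have [S1 SB SM SZ] := S_subalg.
have /fin_all_exists[v vP] h : exists v : D,
    [/\ S v, fval v g = 1 & h != g -> fval v h = 0].
  have [->|neq_hg] := eqVneq h g; first by exists 1; rewrite fval1.
  have [f Sf neq_f] := S_sep neq_hg.
  exists ((fval f g - fval f h)^-1 *: (f - fval f h *: 1)); split=> [||_].
  - by apply: (SZ) => //; apply: SB => //; apply: SZ.
  - rewrite fvalZ fvalB fvalZ fval1 mulr1 mulVf // subr_eq0.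
    by rewrite eq_sym.
  by rewrite fvalZ fvalB fvalZ fval1 mulr1 subrr mulr0.
have fval_prod k : fval (\prod_h v h) k = \prod_h fval (v h) k.
  by apply: (big_morph (fval^~ k)) => [f f'|]; rewrite ?fvalM ?fval1.
exists (\prod_h v h) => [|h].
  by apply: (is_subalg_prod _ S_subalg) => h _; case: (vP h).
rewrite fval_prod; have [->|neq_hg] := eqVneq h g.
  by rewrite big1 // => k _; case: (vP k).
by rewrite (bigD1 h) //=; have [_ _ ->] := vP h; rewrite ?mul0r.
Qed.

(** A finite form of the Stone-Weierstrass theorem: every function is the
    combination of indicators of points weighted by its values. *)
Lemma separating_subalg f : S f.
Proof.
have [S1 SB SM SZ] := S_subalg.
have /fin_all_exists2[u Su uE] := separating_indicator.
have -> : f = \sum_g fval f g *: u g.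
  apply: fval_inj => h; rewrite fval_sum (bigD1 h) //= fvalZ uE eqxx mulr1.
  rewrite big1 ?addr0 // => g neq_gh.
  by rewrite fvalZ uE eq_sym (negPf neq_gh) mulr0.
by apply: (is_subalg_sum S_subalg) => g; apply: SZ.
Qed.
End Separation.

Definition additive_char f :=
  forall g h, fval f (g * h)%g = fval f g + fval f h.

Lemma additive_char1 f : additive_char f -> fval f 1%g = 0.
Proof.
by move=> addf; apply: (addrI (fval f 1%g)); rewrite -addf mulg1 addr0.
Qed.

Lemma additive_charV f g : additive_char f -> fval f g^-1%g = - fval f g.
Proof.
move=> addf; apply: (addIr (fval f g)).
by rewrite -addf mulVg additive_char1 // addNr.
Qed.

(** Both sides are determined by the associated bilinear forms on K[G], and
    these need only be compared on pairs of group elements, where the equality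
    is the additivity of [f]. *)
Lemma comul_additive_char f : additive_char f ->
  dual_comul f = tens f 1 + tens 1 f.
Proof.
move=> addf; apply: pairing2P => a b; rewrite pairing2_comul.
rewrite -[tens f 1]scale1r linear_pairing2 scale1r !pairing2_tens.
have pairingP (u : D) k c c' :
    pairing u (k *: c + c') = k * pairing u c + pairing u c' by exact: linearP.
elim/gelt_ind: a => [g|k a a' IHa IHa']; last first.
  by rewrite mulrDl -scalerAl !pairingP IHa IHa'; ring.
elim/gelt_ind: b => [h|k b b' IHb IHb']; last first.
  by rewrite mulrDr -scalerAr !pairingP IHb IHb'; ring.
by rewrite geltM -!/(fval _ _) addf !fval1 mulr1 mul1r.
Qed.

Lemma antipodeM f f' :
  dual_antipode (f * f') = dual_antipode f * dual_antipode f' :> D.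
Proof.
apply: fval_inj => g.
by rewrite fvalM ![fval (dual_antipode _) g]fval_antipode fvalM.
Qed.

End FunctionAlgebra.

(** * Hopf orders generated by additive characters *)

Section TensorSquare.
Variables (K : fieldType) (R : set K) (B : falgType K) (H : set B).
Hypothesis H_subalg : is_subalg R H.
Local Notation H2 := (tensor_square H).

Lemma tensor_square_tens u v : H u -> H v -> H2 (tens u v).
Proof.
move=> Hu Hv; exists [:: (u, v)]; split=> [w|]; last by rewrite big_seq1.
by rewrite inE => /eqP ->.
Qed.

Lemma tensor_squareD s t : H2 s -> H2 t -> H2 (s + t).
Proof.
move=> [l [Hl ->]] [m [Hm ->]]; exists (l ++ m); rewrite big_cat; split=> // u.
by rewrite mem_cat => /orP[/Hl|/Hm].
Qed.

Lemma tensor_square_sum (J : eqType) (l : seq J) (F : J -> tensor B B) :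
  (forall j, j \in l -> H2 (F j)) -> H2 (\sum_(j <- l) F j).
Proof.
move=> HF; rewrite big_seq; elim/big_ind: _ => //; last exact: tensor_squareD.
by exists [::]; rewrite big_nil.
Qed.

Lemma tensor_squareZ k t : R k -> H2 t -> H2 (k *: t).
Proof.
have [_ _ _ HZ] := H_subalg.
move=> Rk [l [Hl ->]]; rewrite scaler_sumr.
apply: tensor_square_sum => u /Hl[Hu1 Hu2].
have <- : tens (k *: u.1) u.2 = k *: tens u.1 u.2.
  by apply/matrixP=> i j; rewrite !mxE linearZ /= mulrA.
by apply: tensor_square_tens => //; apply: HZ.
Qed.

Lemma tensor_squareM s t : H2 s -> H2 t -> H2 (tmul s t).
Proof.
have [_ _ HM _] := H_subalg; have [tmull tmulr] := bilin_tmul B.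
have linear_big (f : tensor B B -> tensor B B) (l : seq (B * B)) F :
    linear f -> f (\sum_(u <- l) F u) = \sum_(u <- l) f (F u).
  move=> linf; pose fl := GRing.isLinear.Build K _ _ _ f linf.
  exact: (linear_sum (HB.pack f fl : {linear _ -> _})).
move=> [l [Hl ->]] [m [Hm ->]].
rewrite (linear_big _ _ _ (tmull _)).
apply: tensor_square_sum => u /Hl[Hu1 Hu2].
rewrite (linear_big _ _ _ (tmulr _)).
apply: tensor_square_sum => v /Hm[Hv1 Hv2].
by rewrite tmul_tens; apply: tensor_square_tens; apply: HM.
Qed.
End TensorSquare.

(** The mechanism behind the result, for any number of generators: R-linear
    relations for the p-th powers make the p^n reduced monomials an R-spanning
    family, separation of points makes them span over K, and counting makes
    them a basis.  Stability under the structure maps follows from their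
    multiplicativity and their values on primitive generators. *)
Theorem hopf_order_additive_chars (K : fieldType) (gT : finGroupType)
    (R : set K) (n p : nat) (x : 'I_n -> dual (group_hopf K gT)) :
    subring_set R -> (1 < p)%N -> #|gT| = (p ^ n)%N ->
    (forall i, additive_char (x i)) ->
    (forall g h, (forall i, fval (x i) g = fval (x i) h) -> g = h) ->
    (forall i, lincomb R x (x i ^+ p)) ->
  hopf_order R (B := dual_hopf (group_hopf K gT))
    (gen_subalg R [set x i | i in [set: 'I_n]]%classic).
Proof.
move=> R_subring p_gt1 cardG x_add x_sep xp_lincomb.
have K_subring : subring_set (@setT K) by split.
have xp_K i : lincomb setT x (x i ^+ p).
  by have [c _ ->] := xp_lincomb i; exists c.
set H := gen_subalg _ _.
have H_subalg : is_subalg R H.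
  rewrite /H (gen_subalg_red_monom R_subring p_gt1) //.
  exact: is_subalg_red_monom.
have xH i : H (x i) by move=> H' [_]; apply; exists i.
have [H1 HB HM HZ] := H_subalg.
have [R1 RB RM] := R_subring.
have Hmin (P : set (dual (group_hopf K gT))) :
    is_subalg R P -> (forall i, P (x i)) -> forall u, H u -> P u.
  by move=> P_subalg Px u; apply; split=> // _ [i _ <-].
split=> //.
- pose e := [seq red_monom x m | m <- enum {ffun 'I_n -> 'I_p}].
  have size_e : size e == \dim {: dual_hopf (group_hopf K gT)}.
    by rewrite size_map -cardE card_ffun !card_ord dim_dual cardG.
  exists (Tuple size_e); split; last first.
    rewrite (@rspan_image _ _ _ _ (@red_monom _ _ n p x)) //.
    exact: gen_subalg_red_monom.
  rewrite basisEdim (eqP size_e) leqnn andbT; apply/subvP => u _.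
  (* Over K the span of the reduced monomials is again a subalgebra. *)
  have K_subalg := is_subalg_red_monom K_subring p_gt1 xp_K.
  have [|c _ ->] := separating_subalg K_subalg _ u.
    move=> g h neq_gh.
    have [i neq_i|eq_gh] := pickP (fun i => fval (x i) g != fval (x i) h).
      by exists (x i) => //; apply: red_monom_gen.
    by case/eqP: neq_gh; apply: x_sep => i; apply/eqP/negbFE/eq_gh.
  apply: memv_suml => m _; apply: memvZ; apply: memv_span; apply: map_f.
  exact: mem_enum.
- apply: Hmin => [|i].
    split=> [|u v Hu Hv|u v Hu Hv|k u Rk Hu]; rewrite /mkset.
    + by rewrite comul1; exact: (tensor_square_tens H1 H1).
    + rewrite linearB -scaleN1r; apply: tensor_squareD => //.
      apply: (tensor_squareZ H_subalg) => //.
      exact: subring_setN.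
    + by rewrite comulM; exact: (tensor_squareM H_subalg Hu Hv).
    + by rewrite linearZ; exact: (tensor_squareZ H_subalg Rk Hu).
  rewrite /mkset /= comul_additive_char //; apply: tensor_squareD;
  exact: tensor_square_tens.
- apply: Hmin => [|i].
    split=> [|u v Ru Rv|u v Ru Rv|k u Rk Ru]; rewrite /mkset.
    + by rewrite counit1.
    + by rewrite linearB; apply: RB.
    + by rewrite counitM; apply: RM.
    + by rewrite linearZ; apply: RM.
  by rewrite /mkset counit_fval additive_char1 //; apply: subring_set0.
apply: Hmin => [|i].
  split=> [|u v Hu Hv|u v Hu Hv|k u Rk Hu]; rewrite /mkset.
  + have -> : antipode (1 : dual_hopf (group_hopf K gT)) = 1.
      by apply: fval_inj => g; rewrite fval_antipode !fval1.
    exact: H1.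
  + by rewrite linearB; apply: HB.
  + by rewrite [antipode _]antipodeM; apply: HM.
  + by rewrite linearZ; apply: HZ.
have -> : antipode (x i : dual_hopf (group_hopf K gT)) = -1 *: x i.
  by apply: fval_inj => g; rewrite fval_antipode additive_charV // fvalZ mulN1r.
by apply: HZ => //; apply: subring_setN.
Qed.

(** * The valuation ring *)

Section Valuation.
Variables (K : fieldType) (nu : K -> \bar int).
Hypothesis nu_val : discrete_valuation nu.

Lemma valuation_fin x : x != 0 -> exists m, nu x = m%:E.
Proof.
have [nuNy nuy _ _] := nu_val; move=> x_neq0.
case nux: (nu x) => [m||]; first by exists m.
  by move/nuy: nux => /eqP; rewrite (negPf x_neq0).
by case: (nuNy x).
Qed.

Lemma valuation1 : nu 1 = 0%:E.
Proof.
have [_ _ nuM _] := nu_val; have [m num] := valuation_fin (oner_neq0 K).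
move: (nuM 1 1); rewrite mulr1 num -EFinD => -[] ?; congr _%:E; lia.
Qed.

Lemma valuationN1 : nu (-1) = 0%:E.
Proof.
have [_ _ nuM _] := nu_val.
have [|m num] := @valuation_fin (-1); first by rewrite oppr_eq0 oner_neq0.
move: (nuM (-1) (-1)); rewrite mulrNN mulr1 valuation1 num -EFinD => -[] ?.
congr _%:E; lia.
Qed.

Lemma valuation_ring_subring : subring_set (valuation_ring nu).
Proof.
have [_ _ nuM nuD] := nu_val; rewrite /valuation_ring.
split=> [|x y Rx Ry|x y Rx Ry]; rewrite /mkset /=.
- by rewrite valuation1.
- apply: le_trans (nuD _ _); rewrite le_min Rx -mulN1r nuM valuationN1 add0e.
  exact: Ry.
by rewrite nuM adde_ge0.
Qed.

Variable pi : K.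
Hypothesis nu_pi : nu pi = 1%:E.

Lemma uniformizer_neq0 : pi != 0.
Proof.
have [_ nuy _ _] := nu_val.
by apply/eqP => pi0; have /nuy := pi0; rewrite nu_pi.
Qed.

Lemma valuationX m : nu (pi ^+ m) = m%:Z%:E.
Proof.
have [_ _ nuM _] := nu_val; elim: m => [|m IHm].
  by rewrite expr0 valuation1.
by rewrite exprS nuM nu_pi IHm -EFinD; congr _%:E; lia.
Qed.

(** Converts a lower bound on a valuation, in the form of the hypotheses on mu,
    alpha and beta, into integrality of a structure constant of the order. *)
Lemma valuation_ring_div x m n :
  ((m%:Z - n%:Z)%:E <= nu x)%E -> valuation_ring nu (pi ^+ n * x / pi ^+ m).
Proof.
have [_ _ nuM _] := nu_val; have pim := expf_neq0 m uniformizer_neq0.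
rewrite /valuation_ring /mkset /= => le_x.
have: nu (pi ^+ n * x / pi ^+ m * pi ^+ m) = nu (pi ^+ n * x) by rewrite divfK.
rewrite nuM [in RHS]nuM !valuationX.
move: le_x; case: (nu x) => [k||]; case: (nu _) => [l||] //=.
by rewrite -!EFinD !lee_fin => le_x [?]; lia.
Qed.

End Valuation.

(** * The coordinate characters *)

Section DualMonomials.
Variables (K : fieldType) (p : nat) (gT : finGroupType) (g1 g2 g3 : gT).

Lemma gelt_expg g n : gelt K (g ^+ n)%g = gelt K g ^+ n :> group_alg K gT.
Proof.
by elim: n => [|n IHn]; rewrite ?expg0 ?gelt1 // expgS exprS -geltM IHn.
Qed.

(** The sum runs up to [p] and not [j] so that the powers of [u - 1] are those
    on which the [dual_monomial] functionals are specified. *)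
Lemma exprn_sub1 (A : algType K) (u : A) j : (j < p)%N ->
  u ^+ j = \sum_(i < p) 'C(j, i)%:R *: (u - 1) ^+ i.
Proof.
move=> lt_jp; rewrite -{1}(subrK 1 u) exprD1n
  (@big_ord_widen _ _ _ _ p (fun i => (u - 1) ^+ i *+ 'C(j, i))) // big_mkcond.
apply: eq_bigr => i _; rewrite scaler_nat ltnS.
by case: leqP => // lt_ji; rewrite bin_small // mulr0n.
Qed.

(** Expanding each gi^n = (1 + (gi - 1))^n writes a group element in the basis
    of K[G] to which [xi] is dual. *)
Lemma dual_monomial_binomial a b c (xi : dual (group_hopf K gT)) j k l :
    (a < p)%N -> (b < p)%N -> (c < p)%N ->
    (j < p)%N -> (k < p)%N -> (l < p)%N ->
  dual_monomial p g1 g2 g3 a b c xi ->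
  fval xi (g1 ^+ j * g2 ^+ k * g3 ^+ l)%g =
    ('C(j, a) * 'C(k, b) * 'C(l, c))%:R.
Proof.
move=> lt_a lt_b lt_c lt_j lt_k lt_l xi_def.
have sum_delta d m : (d < p)%N ->
    \sum_(i < p) 'C(m, i)%:R * (d == i)%:R = 'C(m, d)%:R :> K.
  move=> lt_d; rewrite (bigD1 (Ordinal lt_d)) //= eqxx mulr1.
  rewrite big1 ?addr0 // => i.
  by rewrite eq_sym -val_eqE /= => /negPf ->; rewrite mulr0.
(* The algebra structures of [group_alg] and of [group_hopf] agree only
   up to conversion; [P] lives on the former, where the sums are taken. *)
pose P : {linear group_alg K gT -> K^o} :=
  pairing xi : {linear group_hopf K gT -> K^o}.
rewrite -[LHS]/(P _) -!geltM !gelt_expg !exprn_sub1 // !natrM -!sum_delta //.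
rewrite !mulr_suml linear_sum; apply: eq_bigr => i _.
rewrite mulr_sumr [in RHS]mulr_sumr linear_sum; apply: eq_bigr => i' _.
rewrite mulr_sumr [in RHS]mulr_sumr !mulr_suml linear_sum.
apply: eq_bigr => i'' _.
rewrite -!scalerAl -!scalerAr -!scalerAl !linearZ /= [pairing _ _]xi_def //.
by rewrite /GRing.scale /=; ring.
Qed.

End DualMonomials.

Section ElementaryAbelian.
Variables (p : nat) (gT : finGroupType) (g1 g2 g3 : gT).
Hypothesis p_prime : prime p.
Hypothesis G_abelem : (p.-abelem [set: gT])%g.
Hypothesis G_gen : <<[set g1; g2; g3]>>%g = [set: gT].

Let coords j k l : gT := (g1 ^+ j * g2 ^+ k * g3 ^+ l)%g.

Lemma abelem_expg_mod (g : gT) j : (g ^+ (j %% p) = g ^+ j)%g.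
Proof.
by apply: expg_mod; case/(abelemP p_prime): G_abelem => _ -> //; rewrite inE.
Qed.

Lemma abelem_mulgC (g h : gT) : (g * h = h * g)%g.
Proof.
case/(abelemP p_prime): G_abelem => /centsP cGG _.
by apply: (cGG g _ h); rewrite inE.
Qed.

Lemma coordsM j k l j' k' l' :
  (coords j k l * coords j' k' l')%g = coords (j + j') (k + k') (l + l').
Proof.
have mulgACA (u v w z : gT) : (u * v * (w * z) = u * w * (v * z))%g.
  rewrite -(mulgA u) -(mulgA u w); congr (_ * _)%g.
  by rewrite !mulgA (abelem_mulgC v).
by rewrite /coords !expgD mulgACA (mulgACA (g1 ^+ j)%g).
Qed.

Lemma coords_surj (g : gT) : exists j k l,
  [/\ (j < p)%N, (k < p)%N, (l < p)%N & g = coords j k l].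
Proof.
have cGG (A B : {set gT}) : A \subset 'C(B)%g.
  by apply/centsP => u _ v _; apply: abelem_mulgC.
have : g \in (<[g1]> <*> <[g2]> <*> <[g3]>)%g.
  rewrite /cycle joing_idl !joing_idr (joingE [set g1]) joing_idl joingE.
  by rewrite G_gen inE.
rewrite (@cent_joinEr _ (<[g1]> <*> <[g2]>)%G <[g3]>%G) //=.
rewrite (@cent_joinEr _ <[g1]>%G <[g2]>%G) //.
case/mulsgP => _ _ /mulsgP[_ _ /cycleP[j ->] /cycleP[k ->] ->] /cycleP[l ->] ->.
have p_gt0 := prime_gt0 p_prime.
exists (j %% p)%N, (k %% p)%N, (l %% p)%N.
by rewrite !ltn_pmod // /coords !abelem_expg_mod.
Qed.

Variable K : fieldType.
Hypothesis K_char : p \in [pchar K].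

(** A functional of degree one reads off one of the three exponents.  Exponents
    are first reduced modulo p, where [dual_monomial_binomial] applies, and the reduction is invisible in K. *)
Lemma dual_monomial_linear a b c (xi : dual (group_hopf K gT)) :
    dual_monomial p g1 g2 g3 a b c xi -> (a + b + c = 1)%N ->
  forall j k l, fval xi (coords j k l) = (a * j + b * k + c * l)%:R.
Proof.
move=> xi_def abc1 j k l.
have [p_gt0 p_gt1] := (prime_gt0 p_prime, prime_gt1 p_prime).
rewrite /coords -(abelem_expg_mod g1 j) -(abelem_expg_mod g2 k)
  -(abelem_expg_mod g3 l).
rewrite (dual_monomial_binomial _ _ _ _ _ _ xi_def) ?ltn_pmod //; try lia.
have -> : ('C(j %% p, a) * 'C(k %% p, b) * 'C(l %% p, c))%N =
    (a * (j %% p) + b * (k %% p) + c * (l %% p))%N.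
  move: a b c abc1 {xi_def} => [|[|a]] [|[|b]] [|[|c]] // _;
  by rewrite !bin0 !bin1; lia.
by rewrite !natrD !natrM !(GRing.natr_mod_pchar K_char).
Qed.

Lemma dual_monomial_additive a b c (xi : dual (group_hopf K gT)) :
  dual_monomial p g1 g2 g3 a b c xi -> (a + b + c = 1)%N -> additive_char xi.
Proof.
move=> xi_def abc1 g h.
have [j [k [l [_ _ _ ->]]]] := coords_surj g.
have [j' [k' [l' [_ _ _ ->]]]] := coords_surj h.
by rewrite coordsM !(dual_monomial_linear xi_def abc1) -natrD; congr _%:R; lia.
Qed.

End ElementaryAbelian.

(** * The theorem *)

Lemma natr_pchar_inj (R : nzRingType) (p : nat) (a b : nat) :
  p \in [pchar R] -> (a < p)%N -> (b < p)%N -> a%:R = b%:R :> R -> a = b.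
Proof.
move=> R_char; wlog le_ab : a b / (a <= b)%N => [IH lt_a lt_b eq_ab|].
  by case: (leqP a b) => [|/ltnW] /IH ->.
move=> _ lt_b eq_ab; have : (p %| b - a)%N.
  by rewrite (dvdn_pcharf R_char) natrB // eq_ab subrr.
by move/dvdn_leq; lia.
Qed.

(** The Frobenius is additive and fixes the prime field. *)
Lemma exprp_sub_natr (K : fieldType) (p : nat) (y m : K) (b : nat) :
  p \in [pchar K] -> (y - m * b%:R) ^+ p = y ^+ p - m ^+ p * b%:R.
Proof.
move=> K_char; rewrite -!(pFrobenius_autE K_char).
by rewrite rmorphB rmorphM rmorph_nat.
Qed.

Lemma exprp_natr (K : fieldType) (p a : nat) :
  p \in [pchar K] -> a%:R ^+ p = a%:R :> K.
Proof. by move=> K_char; rewrite -(pFrobenius_autE K_char) rmorph_nat. Qed.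

Theorem proposition4p1 (p : nat) (K : fieldType) (nu : K -> \bar int) (pi : K)
    (gT : finGroupType) (g1 g2 g3 : gT)
    (xi100 xi010 xi001 : dual (group_hopf K gT))
    (i1 i2 i3 : nat) (mu alpha beta : K)
    (p_prime : prime p)
    (K_char : p \in [pchar K])
    (nu_val : discrete_valuation nu)
    (nu_complete : valuation_complete nu)
    (nu_pi : nu pi = 1%:E)
    (G_abelem : (p.-abelem [set: gT])%g)
    (G_card : #|gT| = (p ^ 3)%N)
    (G_gen : <<[set g1; g2; g3]>>%g = [set: gT])
    (xi100_def : dual_monomial p g1 g2 g3 1 0 0 xi100)
    (xi010_def : dual_monomial p g1 g2 g3 0 1 0 xi010)
    (xi001_def : dual_monomial p g1 g2 g3 0 0 1 xi001)
    (mu_bound : ((i2%:Z - p%:Z * i1%:Z)%:E <= nu (wp p mu))%E)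
    (alpha_bound :
       ((i3%:Z - p%:Z * i1%:Z)%:E <= nu (wp p alpha + wp p mu * beta)%R)%E)
    (beta_bound : ((i3%:Z - p%:Z * i2%:Z)%:E <= nu (wp p beta))%E) :
  hopf_order (valuation_ring nu) (B := dual_hopf (group_hopf K gT))
    (gen_subalg (valuation_ring nu)
       [set pi ^+ i1 *: (xi100 - mu *: xi010 - alpha *: xi001);
            pi ^+ i2 *: (xi010 - beta *: xi001);
            pi ^+ i3 *: xi001]%classic).
Proof.
have R_subring := valuation_ring_subring nu_val.
have R0 := subring_set0 R_subring.
have pi_neq0 := uniformizer_neq0 nu_val nu_pi.
pose x1 := pi ^+ i1 *: (xi100 - mu *: xi010 - alpha *: xi001).
pose x2 := pi ^+ i2 *: (xi010 - beta *: xi001).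
pose x3 := pi ^+ i3 *: xi001.
pose x (i : 'I_3) := nth 0 [:: x1; x2; x3] i.
have -> : [set x1; x2; x3]%classic = [set x i | i in [set: 'I_3]]%classic.
  apply/seteqP; split=> y.
    by case=> [[->|->]|->]; [exists ord0|exists (inord 1)|exists ord_max];
      rewrite // /x inordK.
  case=> -[[|[|[|i]]] //= lt_i3] _ <-; rewrite /x /=.
  - by left; left.
  - by left; right.
  by right.
have x1E g : fval x1 g =
    pi ^+ i1 * (fval xi100 g - mu * fval xi010 g - alpha * fval xi001 g).
  by rewrite fvalZ !fvalB !fvalZ.
have x2E g : fval x2 g = pi ^+ i2 * (fval xi010 g - beta * fval xi001 g).
  by rewrite fvalZ !fvalB !fvalZ.
have x3E g : fval x3 g = pi ^+ i3 * fval xi001 g by rewrite fvalZ.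
have coordsE := coords_surj p_prime G_abelem G_gen.
have linE a b c xi :=
  @dual_monomial_linear _ _ g1 g2 g3 p_prime G_abelem _ K_char a b c xi.
have xi100_lin := linE _ _ _ _ xi100_def (erefl _).
have xi010_lin := linE _ _ _ _ xi010_def (erefl _).
have xi001_lin := linE _ _ _ _ xi001_def (erefl _).
have addE a b c xi := @dual_monomial_additive
  _ _ _ _ _ p_prime G_abelem G_gen _ K_char a b c xi.
have xi100_add := addE _ _ _ _ xi100_def (erefl _).
have xi010_add := addE _ _ _ _ xi010_def (erefl _).
have xi001_add := addE _ _ _ _ xi001_def (erefl _).
apply: (hopf_order_additive_chars R_subring (prime_gt1 p_prime) G_card)
  => [i g h|g h eq_gh|i].
- case: i => [[|[|[|i]]] //= lt_i3]; rewrite /x /= ?x1E ?x2E ?x3E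
    ?xi100_add ?xi010_add ?xi001_add; ring.
- (* The change of coordinates is triangular: recover the third coordinate, *)
  (* then the second, then the first.                                       *)
  have := eq_gh (inord 2); have := eq_gh (inord 1); have := eq_gh ord0.
  rewrite /x !inordK //= x1E x1E x2E x2E x3E x3E.
  have pi_inj i := mulfI (expf_neq0 i pi_neq0).
  move=> /pi_inj eq1 /pi_inj eq2 /pi_inj eq3.
  move: eq2; rewrite eq3 => /addIr eq2.
  move: eq1; rewrite eq2 eq3 => /addIr/addIr.
  move: eq2 eq3 {eq_gh}.
  have [j [k [l [lt_j lt_k lt_l ->]]]] := coordsE g.
  have [j' [k' [l' [lt_j' lt_k' lt_l' ->]]]] := coordsE h.
  rewrite !xi100_lin !xi010_lin !xi001_lin !mul1n !mul0n !addn0 !add0n.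
  have natr_inj a b : (a < p)%N -> (b < p)%N -> a%:R = b%:R :> K -> a = b.
    exact: natr_pchar_inj.
  by move=> /natr_inj -> // /natr_inj -> // /natr_inj -> //.
have xi_natr g : exists a b c,
    [/\ fval xi100 g = a%:R, fval xi010 g = b%:R & fval xi001 g = c%:R].
  have [j [k [l [_ _ _ ->]]]] := coordsE g.
  by rewrite xi100_lin xi010_lin xi001_lin; do 3!eexists.
(* An identity between functions on G is an identity between their values,   *)
(* so the relation for [x i ^+ p] becomes a computation in K.                *)
suff [c [Rc1 Rc2 Rc3] xpE] : exists2 c : K * K * K,
    [/\ valuation_ring nu c.1.1, valuation_ring nu c.1.2
      & valuation_ring nu c.2]
  & forall g, fval (x i) g ^+ p =
      c.1.1 * fval x1 g + c.1.2 * fval x2 g + c.2 * fval x3 g.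
  exists (fun j : 'I_3 => nth 0 [:: c.1.1; c.1.2; c.2] j).
    by case=> -[|[|[|j]]].
  apply: fval_inj => g; rewrite fvalX xpE !big_ord_recl big_ord0 addr0.
  by rewrite !fvalD !fvalZ /= addrA.
(* The factor 1 gives this coefficient the shape of [valuation_ring_div].    *)
have Rpi m : valuation_ring nu (pi ^+ (p * m) * 1 / pi ^+ m).
  apply: valuation_ring_div => //; rewrite valuation1 // lee_fin subr_le0.
  by have := prime_gt0 p_prime; nia.
have p1 := expf_neq0 i1 pi_neq0.
have p2 := expf_neq0 i2 pi_neq0.
have p3 := expf_neq0 i3 pi_neq0.
case: i => [[|[|[|i]]] //= lt_i3]; rewrite /x /=.
- exists (pi ^+ (p * i1) * 1 / pi ^+ i1,
    - (pi ^+ (p * i1) * wp p mu / pi ^+ i2),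
    - (pi ^+ (p * i1) * (wp p alpha + wp p mu * beta) / pi ^+ i3)).
    split=> /=; first exact: Rpi.
      by apply: (subring_setN R_subring); exact: valuation_ring_div.
    by apply: (subring_setN R_subring); exact: valuation_ring_div.
  move=> g /=; have [a [b [c [aE bE cE]]]] := xi_natr g.
  rewrite x1E x2E x3E aE bE cE exprMn -exprM mulnC !exprp_sub_natr //.
  by rewrite exprp_natr // /wp; field; rewrite p1 p2 p3.
- exists (0, pi ^+ (p * i2) * 1 / pi ^+ i2,
    - (pi ^+ (p * i2) * wp p beta / pi ^+ i3)).
    split=> /=; [exact: R0|exact: Rpi|apply: (subring_setN R_subring)].
    exact: valuation_ring_div.
  move=> g /=; have [a [b [c [aE bE cE]]]] := xi_natr g.
  rewrite x1E x2E x3E aE bE cE exprMn -exprM mulnC exprp_sub_natr //.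
  by rewrite exprp_natr // /wp; field; rewrite p2 p3.
exists (0, 0, pi ^+ (p * i3) * 1 / pi ^+ i3).
  by split; [exact: R0|exact: R0|exact: Rpi].
move=> g /=; have [a [b [c [aE bE cE]]]] := xi_natr g.
rewrite x1E x2E x3E aE bE cE exprMn -exprM mulnC exprp_natr //.
by field; rewrite p3.
Qed.
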